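(* Let $p$ be a prime and let $G$ be a torsion-free abelian group with $p$-adic pseudometric $d_p$. Let $d_p^{*p*p}$ denote the $p$-adic metric on the double dual $G^{*p*p}$. Then the map $\Phi^p : G\to \hat{G}^p\subseteq G^{*p*p}$, $g\mapsto \hat{g}^p$, is a pseudo-isometry (it preserves the $p$-adic (pseudo)metrics), and for every $g\in G$, $$d_p(g,0) = d_p^{*p*p}(\hat{g}^p,0) = \max_{f\in G^{*p}} |\hat{g}^p(f)|_p .$$ Furthermore, $\hat{G}^p$ is dense in $G^{*p*p}$ in the relative topology.
   Context: $\mathbb{Z}_p$ denotes the $p$-adic integers and $|\cdot|_p$ the $p$-adic absolute value. For a torsion-free abelian group $G$, the $p$-adic pseudometric is $d_p(g,h)=p^{-k}$, where $k\ge 0$ is the largest integer such that $g-h\in p^kG$, and $d_p(g,h)=0$ if $g-h\in p^kG$ for all $k$. Write $G^{*p} = \mathrm{Hom}(G,\mathbb{Z}_p)$ for the group of all group homomorphisms $G\to\mathbb{Z}_p$. It is again a torsion-free abelian group, so $G^{*p*p} = \mathrm{Hom}(G^{*p},\mathbb{Z}_p)$ is defined, and its $p$-adic pseudometric $d_p^{*p*p}$ is a metric. For $g\in G$, $\hat{g}^p\in G^{*p*p}$ is defined by $\hat{g}^p(f)=f(g)$ for $f\in G^{*p}$; $\Phi^p(g)=\hat{g}^p$ and $\hat{G}^p=\{\hat{g}^p : g\in G\}$. The relative topology on $G^{*p*p}$ is the subspace topology inherited from the product space $\mathbb{Z}_p^{G^{*p}}$ (product topology, each factor with the usual $p$-adic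 topology). *)

(* Defs.v *)
From HB Require Import structures.
From mathcomp Require Import all_boot all_order all_algebra.
From mathcomp Require Import boolp classical_sets topology.

Set Implicit Arguments.
Unset Strict Implicit.
Unset Printing Implicit Defensive.

Import Order.TTheory GRing.Theory Num.Theory.

Local Open Scope classical_set_scope.
Local Open Scope ring_scope.

Definition torsion_free (G : zmodType) : Prop :=
  forall (g : G) (n : nat), (0 < n)%N -> g *+ n = 0 -> g = 0.

Definition is_max d (T : porderType d) (A : set T) (M : T) : Prop :=
  A M /\ ubound A M.

(* In all uses A contains 0 and is downward closed, so that, unless A is all of
   nat, the largest element picked by get exists. The values are powers of p
   or 0, so rat is used as the codomain of all the metrics. *)
Definition padic_size (p : nat) (A : set nat) : rat :=
  if `[< forall k, A k >] then 0 else p%:R ^- get [set k | is_max A k].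

Definition pdist (p : nat) (G : zmodType) (g h : G) : rat :=
  padic_size p [set k | exists x : G, g - h = x *+ (p ^ k)%N].

(* Z_p is the inverse limit of the rings Z/p^n; the n-th residue is represented
   by an integer reduced modulo p^n (coherence with the next residue forces it
   to be reduced). The construction makes sense for every p. *)
Definition coherent (p : nat) (x : nat -> int) : bool :=
  `[< forall n, (x n.+1 %% (p%:Z ^+ n))%Z = x n >].

Record padic_int (p : nat) := PadicInt {
  residue : nat -> int;
  residueP : coherent p residue }.

Section PadicRing.
Variable p : nat.
Local Notation Zp := (padic_int p).
Local Notation q n := (p%:Z ^+ n).

HB.instance Definition _ := [isSub for @residue p].
HB.instance Definition _ := [Choice of Zp by <:].

Lemma residue_inj : injective (@residue p).
Proof. exact: val_inj. Qed.

Lemma residue_mod (x : Zp) n : (residue x n %% q n)%Z = residue x n.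
Proof. by have /asboolP/(_ n) <- := residueP x; rewrite modz_mod. Qed.

Lemma modz_q (a : int) n : ((a %% q n.+1)%Z %% q n)%Z = (a %% q n)%Z.
Proof.
rewrite [in RHS](divz_eq a (q n.+1)) exprS mulrA; exact/esym/modzMDl.
Qed.

Definition reduce (x : nat -> int) (n : nat) : int := (x n %% q n)%Z.

Lemma coherent_reduce (x : nat -> int) :
  (forall n, (x n.+1 %% q n)%Z = (x n %% q n)%Z) -> coherent p (reduce x).
Proof. by move=> h; apply/asboolP => n; rewrite /reduce modz_q h. Qed.

Lemma residueS (x : Zp) n : (residue x n.+1 %% q n)%Z = residue x n.
Proof. by have /asboolP := residueP x; apply. Qed.

Fact zero_coherent : coherent p (reduce (fun=> 0)).
Proof. exact: coherent_reduce. Qed.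

Fact one_coherent : coherent p (reduce (fun=> 1)).
Proof. exact: coherent_reduce. Qed.

Fact opp_coherent (x : Zp) : coherent p (reduce (fun n => - residue x n)).
Proof. by apply: coherent_reduce => n; rewrite -modzNm residueS. Qed.

Fact add_coherent (x y : Zp) :
  coherent p (reduce (fun n => residue x n + residue y n)).
Proof. by apply: coherent_reduce => n; rewrite -modzDm !residueS. Qed.

Fact mul_coherent (x y : Zp) :
  coherent p (reduce (fun n => residue x n * residue y n)).
Proof. by apply: coherent_reduce => n; rewrite -modzMm !residueS. Qed.

Definition padic_zero := PadicInt zero_coherent.
Definition padic_one := PadicInt one_coherent.
Definition padic_opp x := PadicInt (opp_coherent x).
Definition padic_add x y := PadicInt (add_coherent x y).
Definition padic_mul x y := PadicInt (mul_coherent x y).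

Lemma padic_eq (x y : Zp) : residue x =1 residue y -> x = y.
Proof. by move=> /funext /residue_inj. Qed.

Fact padic_addA : associative padic_add.
Proof.
by move=> x y z; apply: padic_eq => n; rewrite /= /reduce modzDml modzDmr addrA.
Qed.

Fact padic_addC : commutative padic_add.
Proof. by move=> x y; apply: padic_eq => n; rewrite /= /reduce addrC. Qed.

Fact padic_add0 : left_id padic_zero padic_add.
Proof.
by move=> x; apply: padic_eq => n; rewrite /= /reduce modzDml add0r residue_mod.
Qed.

Fact padic_addN : left_inverse padic_zero padic_opp padic_add.
Proof.
by move=> x; apply: padic_eq => n; rewrite /= /reduce modzDml addNr.
Qed.

HB.instance Definition _ :=
  GRing.isZmodule.Build Zp padic_addA padic_addC padic_add0 padic_addN.

Fact padic_mulA : associative padic_mul.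
Proof.
by move=> x y z; apply: padic_eq => n; rewrite /= /reduce modzMml modzMmr mulrA.
Qed.

Fact padic_mulC : commutative padic_mul.
Proof. by move=> x y; apply: padic_eq => n; rewrite /= /reduce mulrC. Qed.

Fact padic_mul1 : left_id padic_one padic_mul.
Proof.
by move=> x; apply: padic_eq => n; rewrite /= /reduce modzMml mul1r residue_mod.
Qed.

Fact padic_mulDl : left_distributive padic_mul +%R.
Proof.
move=> x y z; apply: padic_eq => n /=.
by rewrite /reduce modzMml modzDm mulrDl.
Qed.

HB.instance Definition _ := GRing.Zmodule_isComPzRing.Build Zp
  padic_mulA padic_mulC padic_mul1 padic_mulDl.

Definition padic_abs (x : Zp) : rat :=
  padic_size p [set k | exists y : Zp, x = p%:R ^+ k * y].

Local Notation dvd k x := (exists y : Zp, x = p%:R ^+ k * y).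

Lemma residueD (x y : Zp) n :
  residue (x + y) n = ((residue x n + residue y n) %% q n)%Z.
Proof. by []. Qed.

Lemma padic_dvd_le k j (x : Zp) : (j <= k)%N -> dvd k x -> dvd j x.
Proof.
by move=> jk [y ->]; exists (p%:R ^+ (k - j) * y); rewrite mulrA -exprD subnKC.
Qed.

Lemma residue_natmul (x : Zp) (m n : nat) :
  residue (m%:R * x) n = ((m%:Z * residue x n) %% q n)%Z.
Proof.
elim: m => [|m IH]; first by rewrite !mul0r /= /reduce mod0z.
rewrite -[in LHS]natr1 mulrDl mul1r residueD IH modzDml.
by rewrite intS addrC mulrDl mul1r.
Qed.

Lemma padic_dvd_residue k (x : Zp) : dvd k x -> residue x k = 0.
Proof.
move=> [y ->]; rewrite -natrX residue_natmul.
by rewrite -[(p ^ k)%N%:Z]natz natrX natz modzMr.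
Qed.

Lemma padic_dvd_all (x : Zp) : (forall k, dvd k x) -> x = 0.
Proof.
move=> h; apply: padic_eq => n; rewrite padic_dvd_residue //.
by rewrite /= /reduce mod0z.
Qed.

Lemma padic_val_ex (x : Zp) : ~ (forall k, dvd k x) ->
  is_max [set k | dvd k x] (get [set k | is_max [set k | dvd k x] k]).
Proof.
move=> /existsNP[k0 nk0]; apply: (@getPex _ [set k | is_max _ k]).
have bnd k : `[< dvd k x >] -> (k <= k0)%N.
  move=> /asboolP kx; rewrite leqNgt; apply/negP => /ltnW kk.
  by apply: nk0; apply: padic_dvd_le kx.
have ex0 : exists k, `[< dvd k x >].
  by exists 0%N; apply/asboolP; exists x; rewrite expr0 mul1r.
case: (ex_maxnP ex0 bnd) => k /asboolP kx kmax.
by exists k; split=> // j /asboolP jx; apply: kmax.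
Qed.

Lemma padic_abs_ge0 (x : Zp) : 0 <= padic_abs x.
Proof.
rewrite /padic_abs /padic_size; case: ifP => // _.
by rewrite invr_ge0 exprn_ge0 // ler0n.
Qed.

Lemma padic_abs0 : padic_abs 0 = 0.
Proof.
rewrite /padic_abs /padic_size; case: asboolP => // -[] k.
by exists 0; rewrite mulr0.
Qed.

Lemma padic_dvd_p0 k (x : Zp) : p = 0%N -> (0 < k)%N -> dvd k x -> x = 0.
Proof.
move=> p0 k0 [y ->]; have -> : p%:R = 0 :> Zp.
  exact: (congr1 (GRing.natmul (1 : Zp)) p0).
by rewrite expr0n eqn0Ngt k0 mul0r.
Qed.

Lemma padic_abs_eq0 (x : Zp) : padic_abs x = 0 -> x = 0.
Proof.
rewrite /padic_abs /padic_size; case: asboolP => [/padic_dvd_all //|nx].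
have [] := padic_val_ex nx; set k := get _ => kx _ /eqP.
rewrite invr_eq0 expf_eq0 => /andP[k0]; rewrite pnatr_eq0 => /eqP p0.
exact: padic_dvd_p0 kx.
Qed.

Lemma le_padic_abs (x y : Zp) :
  (forall k, dvd k y -> dvd k x) -> padic_abs x <= padic_abs y.
Proof.
move=> yx; have [x0|nx] := pselect (x = 0).
  by rewrite x0 padic_abs0 padic_abs_ge0.
have nxx : ~ (forall k, dvd k x) by move/padic_dvd_all.
have nyy : ~ (forall k, dvd k y) by move=> h; apply: nxx => k; apply/yx/h.
rewrite /padic_abs /padic_size; case: asboolP => // _; case: asboolP => // _.
have [] := padic_val_ex nxx; have [] := padic_val_ex nyy.
set j := get _ => jy _; set k := get _ => kx kmax.
have jk : (j <= k)%N by apply: kmax; apply: yx.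
case: (posnP p) => [p0|p_gt0].
  have k0 : k = 0%N.
    by apply/eqP; rewrite eqn0Ngt; apply/negP => k0; apply/nx/(padic_dvd_p0 p0 k0).
  by move: jk; rewrite k0 leqn0 => /eqP ->.
rewrite lef_pV2 ?posrE ?exprn_gt0 ?ltr0n //.
by apply: ler_weXn2l; rewrite // ler1n.
Qed.

Lemma padic_absN (x : Zp) : padic_abs (- x) = padic_abs x.
Proof.
have dN k (z : Zp) : dvd k z -> dvd k (- z).
  by move=> [y ->]; exists (- y); rewrite mulrN.
apply/eqP; rewrite eq_le !le_padic_abs // => k; last exact: dN.
by move/dN; rewrite opprK.
Qed.

Lemma padic_abs_ultra (x y : Zp) :
  padic_abs (x + y) <= Num.max (padic_abs x) (padic_abs y).
Proof.
have dD k (a b : Zp) : dvd k a -> dvd k b -> dvd k (a + b).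
  by move=> [u ->] [v ->]; exists (u + v); rewrite mulrDr.
have [xy|] := pselect (forall k, dvd k x -> dvd k y).
  by rewrite le_max le_padic_abs // => k kx; apply: dD => //; apply: xy.
move=> /existsNP[k0 /not_implyP[k0x k0y]].
rewrite le_max orbC le_padic_abs // => k ky; apply: dD => //.
apply: padic_dvd_le k0x; rewrite leqNgt; apply/negP => /ltnW k0k.
by apply: k0y; apply: padic_dvd_le ky.
Qed.

Fact padic_distxx (x : Zp) : padic_abs (x - x) = 0.
Proof. by rewrite subrr padic_abs0. Qed.

Fact padic_dist_pos (x y : Zp) : padic_abs (x - y) = 0 -> x = y.
Proof. by move/padic_abs_eq0/eqP; rewrite subr_eq0 => /eqP. Qed.

Fact padic_dist_sym (x y : Zp) : padic_abs (x - y) = padic_abs (y - x).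
Proof. by rewrite -padic_absN opprB. Qed.

Fact padic_dist_triangle (y x z : Zp) :
  padic_abs (x - z) <= padic_abs (x - y) + padic_abs (y - z).
Proof.
rewrite -(subrKA y x (- z)); apply: le_trans (padic_abs_ultra _ _) _.
by rewrite ge_max lerDl lerDr !padic_abs_ge0.
Qed.

HB.instance Definition _ := isMetric.Build rat Zp
  padic_distxx padic_dist_pos padic_dist_sym padic_dist_triangle.

End PadicRing.

Definition hom (U V : zmodType) : Type := {additive U -> V}.

Section HomGroup.
Variables U V : zmodType.

HB.instance Definition _ := gen_eqMixin (hom U V).
HB.instance Definition _ := gen_choiceMixin (hom U V).

Definition hom_fun (f : hom U V) : U -> V := (f : {additive U -> V}).
Coercion hom_fun : hom >-> Funclass.

Lemma hom_eq (f g : hom U V) : f =1 g -> f = g.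
Proof.
case: f g => [f [[hf]]] [g [[hg]]] /funext /= fg; rewrite /hom_fun /= in fg.
by case: _ / fg in hg *; rewrite (Prop_irrelevance hf hg).
Qed.

Definition hom_zero : hom U V := (\0 : {additive U -> V}).
Definition hom_opp (f : hom U V) : hom U V :=
  (\- (f : {additive U -> V}) : {additive U -> V}).
Definition hom_add (f g : hom U V) : hom U V :=
  ((f : {additive U -> V}) \+ (g : {additive U -> V}) : {additive U -> V}).

Fact hom_addA : associative hom_add.
Proof. by move=> f g h; apply: hom_eq => x; apply: addrA. Qed.
Fact hom_addC : commutative hom_add.
Proof. by move=> f g; apply: hom_eq => x; apply: addrC. Qed.
Fact hom_add0 : left_id hom_zero hom_add.
Proof. by move=> f; apply: hom_eq => x; apply: add0r. Qed.
Fact hom_addN : left_inverse hom_zero hom_opp hom_add.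
Proof. by move=> f; apply: hom_eq => x; apply: addNr. Qed.

HB.instance Definition _ :=
  GRing.isZmodule.Build (hom U V) hom_addA hom_addC hom_add0 hom_addN.

End HomGroup.

Definition dual (p : nat) (G : zmodType) : zmodType := hom G (padic_int p).

Section Evaluation.
Variables (p : nat) (G : zmodType).

Definition eval (g : G) (f : dual p G) : padic_int p := hom_fun f g.

Fact eval_is_additive (g : G) : nmod_morphism (eval g).
Proof. by []. Qed.

HB.instance Definition _ (g : G) :=
  GRing.isNmodMorphism.Build (dual p G) (padic_int p) (eval g)
    (eval_is_additive g).

Definition Phi (g : G) : dual p (dual p G) :=
  (eval g : {additive dual p G -> padic_int p}).

Definition dual2_fun (phi : dual p (dual p G)) :
    {ptws dual p G -> padic_int p} := hom_fun phi.

Definition dual2_relative : topologicalType := initial_topology dual2_fun.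

End Evaluation.

Arguments Phi p {G} g.

(* Main.v *)
Require Import Defs.
From HB Require Import structures.
From mathcomp Require Import all_boot all_order all_algebra.
From mathcomp Require Import boolp classical_sets topology.

Set Implicit Arguments.
Unset Strict Implicit.
Unset Printing Implicit Defensive.

Import Order.TTheory GRing.Theory Num.Theory.

Local Open Scope classical_set_scope.
Local Open Scope ring_scope.

(** If g is not divisible by p in G, Zorn's lemma gives a subgroup K that is
maximal among those such that m g in p^n G + K forces p^n to divide m.
Maximality makes K closed under division by p and gives G = Zg + p^n G + K for
all n, and the coefficient of g modulo p^n defines a functional f with f(g) = 1.
Dividing out powers of p, every g has a functional f such that p^k divides f(g)
only if p^k divides g, which yields the metric statements.

For density, given psi in the double dual, finitely many functionals and k, we
look for g with psi(f) = f(g) modulo p^k for each of them. If all of them are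
divisible by p, divide by p and lower k; otherwise some f0 takes a unit value at
some g0, and subtracting multiples of f0 makes the others vanish at g0 modulo
p^k, so that one functional less remains and f0 is corrected by a multiple of
g0. *)

(** * Integer congruences, and arithmetic in [padic_int] through residues *)

Lemma PoszX (p k : nat) : p%:Z ^+ k = (p ^ k)%N%:Z.
Proof. by rewrite -[in RHS](natz (p ^ k)) natrX natz. Qed.

Lemma coprimez_prime (p : nat) (m : int) (k : nat) :
  prime p -> ~ (p %| m)%Z -> coprimez (p%:Z ^+ k) m.
Proof.
move=> pp /negP; rewrite dvdzE /= => pm; apply: coprimezXl.
by rewrite coprimezE /= prime_coprime.
Qed.

Lemma modz_modz (a d m : int) : (m %| d)%Z -> ((a %% d)%Z %% m)%Z = (a %% m)%Z.
Proof. by case/dvdzP => e ->; rewrite [in RHS](divz_eq a (e * m)) mulrA modzMDl. Qed.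

Section PadicIntegers.
Variable p : nat.
Local Notation Zp := (padic_int p).

Lemma residue0 n : residue (0 : Zp) n = 0.
Proof. by rewrite /= /reduce mod0z. Qed.

Lemma residue_mulz (x : Zp) (m : int) n :
  residue (x *~ m) n = ((m * residue x n) %% p%:Z ^+ n)%Z.
Proof.
have nat_case (k : nat) : residue (x *+ k) n = ((k%:Z * residue x n) %% p%:Z ^+ n)%Z.
  by rewrite -mulr_natl residue_natmul.
case: m => k; first exact: nat_case.
rewrite NegzE mulrNz -pmulrn.
by rewrite -[LHS]/((- residue (x *+ k.+1) n) %% _)%Z nat_case modzNm mulNr.
Qed.

Lemma residueB (x y : Zp) n :
  residue (x - y) n = ((residue x n - residue y n) %% p%:Z ^+ n)%Z.
Proof. by rewrite residueD -[residue (- y) n]/(_ %% _)%Z modzDmr. Qed.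

Lemma residue_le (x : Zp) m n : (m <= n)%N ->
  residue x m = (residue x n %% p%:Z ^+ m)%Z.
Proof.
move=> /subnKC <-; elim: (n - m)%N => [|k IH]; first by rewrite addn0 residue_mod.
rewrite IH addnS -(residueS x (m + k)) modz_modz //; exact/dvdz_exp2l/leq_addr.
Qed.

(** The quotient comes from a shift: residue [n + k] of [x] is divided by [p ^ k]. *)
Lemma padic_dvdP k (x : Zp) : (0 < p)%N ->
  (exists y, x = y *+ (p ^ k)%N) <-> residue x k = 0.
Proof.
move=> p_gt0; split=> [[y ->]|x0].
  by rewrite pmulrn residue_mulz PoszX modzMr.
have q_gt0 : 0 < p%:Z ^+ k by rewrite exprn_gt0.
pose y n := (residue x (n + k) %/ p%:Z ^+ k)%Z.
have yE n : y n * p%:Z ^+ k = residue x (n + k).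
  by rewrite [RHS](divz_eq _ (p%:Z ^+ k)) -residue_le ?leq_addl // x0 addr0.
have y_coh : coherent p y.
  apply/asboolP => n; apply: (mulIf (lt0r_neq0 q_gt0)).
  by rewrite mulz_modl // !yE -exprD addSn residueS.
exists (PadicInt y_coh); apply: padic_eq => n.
by rewrite pmulrn residue_mulz -PoszX mulrC /= yE -residue_le ?leq_addr.
Qed.

Lemma padic_mulpI (x : Zp) : (0 < p)%N -> x *+ p = 0 -> x = 0.
Proof.
move=> p_gt0 xp0; apply: padic_eq => n; rewrite [RHS]residue0.
have : residue (x *+ p) n.+1 = residue (0 : Zp) n.+1 by rewrite xp0.
rewrite pmulrn residue_mulz residue0 exprS => /dvdz_mod0P.
by rewrite dvdz_mul2l ?pnatr_eq0 -?lt0n // => /dvdz_mod0P; rewrite residueS.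
Qed.

Lemma residue1_neq0 (x : Zp) n : prime p -> residue x 1 <> 0 ->
  coprimez (p%:Z ^+ n) (residue x n).
Proof.
move=> pp x1; case: n => [|n]; first by rewrite expr0 /coprimez gcd1z.
apply: coprimez_prime => // px; apply: x1.
by rewrite (@residue_le x 1 n.+1) // expr1; apply/dvdz_mod0P.
Qed.

(** Bezout inverts the unit [u] modulo [p ^ n], so at this precision an integer multiple of [u] is
    enough. *)
Lemma residue_solve (u x : Zp) n : prime p -> residue u 1 <> 0 ->
  exists c : int, residue (x - u *~ c) n = 0.
Proof.
move=> pp /(residue1_neq0 n pp) /eqP u1.
have [a [b]] := Bezoutz (p%:Z ^+ n) (residue u n); rewrite u1 => ab.
exists (residue x n * b); rewrite residueB residue_mulz -modzDmr modzNm modzDmr.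
apply/dvdz_mod0P/dvdzP; exists (residue x n * a).
by rewrite -[X in X - _]mulr1 -ab mulrDr !mulrA addrK.
Qed.
End PadicIntegers.

(** * A functional with value 1 at an element not divisible by [p] *)

Section Separation.
Variables (p : nat) (p_prime : prime p).
Variables (G : zmodType) (G_tf : torsion_free G).
Variables (g : G) (g_ndiv : ~ exists x, g = x *+ p).
Local Notation q n := (p%:Z ^+ n).

Let q_neq0 n : q n != 0.
Proof. by rewrite expf_neq0 // eqz_nat -lt0n prime_gt0. Qed.

Lemma torsion_free_mulz (x : G) (m : int) : m != 0 -> x *~ m = 0 -> x = 0.
Proof.
case: m => n n0; first by apply: G_tf; case: n n0.
by rewrite NegzE mulrNz => /eqP; rewrite oppr_eq0 => /eqP; apply: G_tf.
Qed.

Lemma pdiv_of_coprime (x y : G) (m : int) :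
  ~ (p %| m)%Z -> x *~ m = y *~ p -> exists z, x = z *~ p.
Proof.
move=> /(coprimez_prime 1 p_prime) /eqP; rewrite expr1 => pm xy.
have [a [b]] := Bezoutz p m; rewrite pm => ab.
exists (x *~ a + y *~ b); rewrite mulrzDl -!mulrzA [b * _]mulrC (mulrzA y) -xy -mulrzA.
by rewrite -mulrzDr [m * b]mulrC ab.
Qed.

(** Torsion-freeness allows factors [p] to be cancelled one at a time; if [p] did not divide [m],
    Bezout would make [g] divisible by [p]. *)
Lemma mulz_dvd n (m : int) (y : G) : g *~ m = y *~ q n -> (q n %| m)%Z.
Proof.
elim: n m y => [|n IH] m y gm; first by rewrite expr0 dvd1z.
have [/dvdzP[m' mE]|/(pdiv_of_coprime (x := g) (y := y *~ q n))] :=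
    pselect (p %| m)%Z; last first.
  rewrite -mulrzA -exprSr => /(_ gm) [x gx].
  by case: g_ndiv; exists x; rewrite pmulrn.
rewrite mE exprSr dvdz_mul2r ?(q_neq0 1) //; apply: (IH _ y).
apply/eqP; rewrite -subr_eq0; apply/eqP.
apply: (@torsion_free_mulz _ p%:Z (q_neq0 1)).
by rewrite mulrzBl -!mulrzA -mE -exprSr gm subrr.
Qed.

(* The images of g modulo p^n G + K have the full order p^n for all n. *)
Definition independent (K : set G) :=
  (forall a b, K a -> K b -> K (a - b)) /\
  forall n m y, K (g *~ m - y *~ q n) -> (q n %| m)%Z.

Lemma independent0 : independent [set 0].
Proof.
split=> [a b -> ->|n m y /eqP]; first by rewrite subr0.
by rewrite subr_eq0 => /eqP; apply: mulz_dvd.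
Qed.

Lemma maximal_independent : exists K, [/\ independent K, K 0 &
  forall x, ~ K x -> exists n m y c,
    K (g *~ m - y *~ q n - x *~ c) /\ ~ (q n %| m)%Z].
Proof.
have [F FP Ftot|K [indK maxK]] := @Zorn_bigcup _ independent.
  split=> [a b [X FX Xa] [Y FY Yb]|n m y [X FX]]; last by have [_] := FP _ FX; apply.
  have [XY|YX] := Ftot _ _ FX FY.
    by exists Y => //; apply: (FP _ FY).1 => //; apply: XY.
  by exists X => //; apply: (FP _ FX).1 => //; apply: YX.
have [subK ndvdK] := indK.
have K0 : K 0.
  (* The empty set is also [independent], so [0] must come from maximality: without [0], [K] would
     be empty and lie strictly below [[set 0]]. *)
  apply: contrapT => nK0; apply: (maxK [set 0] _ independent0).
  split=> [x Kx|/(_ 0 erefl) //].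
  by case: nK0; rewrite -(subrr x); apply: subK.
exists K; split=> // x nKx; apply: contrapT => nex.
(* The subgroup generated by [K] and [x]: if no relation as claimed existed, it would be independent
   and larger than [K]. *)
pose K' := [set z | exists c, K (z - x *~ c)].
apply: (maxK K').
  split=> [z Kz|/(_ x)]; first by exists 0; rewrite mulr0z subr0.
  by move=> /(_ _)/nKx; apply; exists 1; rewrite mulr1z subrr.
split=> [a b [c Ka] [d Kb]|n m y [c Kc]].
  exists (c - d); rewrite mulrzBr.
  suff -> : a - b - (x *~ c - x *~ d) = (a - x *~ c) - (b - x *~ d) by apply: subK.
  by rewrite !opprB [x *~ d - _]addrC addrACA [- b + _]addrC.
by apply: contrapT => nd; apply: nex; exists n, m, y, c.
Qed.

(** * The p-adic coordinate along [g], modulo a maximal independent [K] *)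

Section Coordinate.
Variable K : set G.
Hypotheses (indK : independent K) (K0 : K 0).
Hypothesis maxK : forall x, ~ K x -> exists n m y c,
    K (g *~ m - y *~ q n - x *~ c) /\ ~ (q n %| m)%Z.

Let KB a b : K a -> K b -> K (a - b). Proof. exact: indK.1. Qed.

Let KN a : K a -> K (- a). Proof. by move=> /(KB K0); rewrite sub0r. Qed.

Let KD a b : K a -> K b -> K (a + b).
Proof. by move=> Ka /KN; rewrite -{2}[b]opprK; apply: KB. Qed.

Let KM a (m : int) : K a -> K (a *~ m).
Proof.
move=> Ka; have Kn (n : nat) : K (a *+ n) by elim: n => [//|n IH]; rewrite mulrS; apply: KD.
by case: m => n; [apply: Kn|rewrite NegzE mulrNz; apply/KN/Kn].
Qed.

(** If [x] were outside [K], [p] times the relation given by [maxK] plus [c] times [x *~ p] would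
    eliminate [x] and contradict independence. *)
Lemma pure_p x : K (x *~ p) -> K x.
Proof.
move=> Kpx; apply: contrapT => /maxK[n [m [y [c [Kc]]]]]; apply.
rewrite -(@dvdz_mul2r p%:Z) ?(q_neq0 1) // -exprSr; apply: (indK.2 _ _ y).
have := KD (KM p Kc) (KM c Kpx); rewrite !mulrzBl -!mulrzA -exprSr.
by rewrite [p%:Z * c]mulrC subrK.
Qed.

Lemma pure_q x n : K (x *~ q n) -> K x.
Proof.
elim: n => [|n IH]; first by rewrite expr0 mulr1z.
by rewrite exprSr mulrzA => /pure_p.
Qed.

Lemma coordinate1 x : exists m y, K (x - g *~ m - y *~ p).
Proof.
have [Kx|/maxK[n [m [y [c [Kc nd]]]]]] := pselect (K x).
  by exists 0, 0; rewrite mul0rz mulr0z !subr0.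
(* [p ^ a] is the exact power of [p] in [c]. It is below [p ^ n], as otherwise [x *~ c] would be
   absorbed into the multiple of [p ^ n] and force [q n] to divide [m]. *)
have [a [c' [an [cE c'p]]]] : exists a c', [/\ (a < n)%N, c = c' * q a & ~ (p %| c')%Z].
  have nqc : ~ (q n %| c)%Z.
    move=> /dvdzP[e cE]; apply: nd; apply: (indK.2 _ _ (y + x *~ e)).
    by rewrite mulrzDl -mulrzA -cE opprD addrA.
  elim: n nqc {Kc nd} => [|n IH nqc]; first by rewrite expr0 dvd1z.
  have [qc|/IH[a [c' [an cE c'p]]]] := pselect (q n %| c)%Z; last first.
    by exists a, c'; split=> //; apply: ltnW.
  have /dvdzP[c' cE] := qc; exists n, c'; split=> // /dvdzP[e eE].
  by apply: nqc; apply/dvdzP; exists e; rewrite cE eE -mulrA -exprS.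
have [j nE] : exists j, n = (a + j.+1)%N.
  by exists (n - a.+1)%N; rewrite addnS -addSn subnKC.
(* The other two terms are multiples of [p ^ a], so independence makes [m] one too, and purity
   divides the relation by [p ^ a]. Since [a < n], a factor [p] remains on [y]. *)
have /dvdzP[m' mE] : (q a %| m)%Z.
  apply: (indK.2 _ _ (y *~ q j.+1 + x *~ c')).
  by rewrite mulrzDl -!mulrzA -cE -exprD addnC -nE opprD addrA.
have Kx : K (g *~ m' - y *~ q j.+1 - x *~ c').
  apply: (@pure_q _ a); rewrite !mulrzBl -!mulrzA -cE -mE -exprD addnC.
  by rewrite -nE.
(* With [b * p + e * c' = 1], the relation times [e] expresses [x] modulo [p]. *)
have [b [e]] := Bezoutz p c'.
have /eqP -> := coprimez_prime 1 p_prime c'p; rewrite ?expr1 => be.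
exists (m' * e), (x *~ b - y *~ q j *~ e); have := KN (KM e Kx).
rewrite -{2}[x]mulr1z -be mulrzDr !mulrzBl -!mulrzA [e * p%:Z]mulrC.
rewrite mulrA -exprSr [e * c']mulrC.
move: (g *~ _) (x *~ (b * _)) (x *~ _) (y *~ _) => A B C D.
suff -> : B + C - A - (B - D) = - (A - D - C) by [].
by rewrite [B + C]addrC [C + B - A]addrAC addrKA opprK !opprB [D - A]addrC addrA.
Qed.

(** Applying [coordinate1] to the remainder [y] adds one p-adic digit at a time. *)
Lemma coordinate n x : exists m y, K (x - g *~ m - y *~ q n).
Proof.
elim: n x => [|n IH] x.
  by exists 0, x; rewrite expr0 mulr1z mulr0z subr0 subrr.
have [m [y Ky]] := IH x; have [m' [y' Ky']] := coordinate1 y.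
exists (m + m' * q n), y'; have := KD Ky (KM (q n) Ky').
rewrite !mulrzBl -!mulrzA -exprS mulrzDr opprD !addrA.
by rewrite subrK addrAC.
Qed.

Definition coord n x : int := xget 0 [set m | exists y, K (x - g *~ m - y *~ q n)].

(** Subtracting two decompositions of [x] leaves a relation between [g] and [p ^ n] multiples, to
    which independence applies. *)
Lemma coord_eqmod n x m y : K (x - g *~ m - y *~ q n) ->
  (coord n x = m %[mod q n])%Z.
Proof.
move=> Kx; rewrite /coord; case: xgetP => [z _ [y' Kz]|/(_ m)[]]; last by exists y.
apply/eqP; rewrite eqz_mod_dvd; apply: (indK.2 _ _ (y - y')).
have := KB Kx Kz; rewrite mulrzBr mulrzBl.
move: (g *~ m) (g *~ z) (_ *~ q n) (_ *~ q n) => A C D B.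
suff -> : x - A - B - (x - C - D) = C - A - (B - D) by [].
rewrite -(addrA x) -(addrA x (- C)) opprD addrACA subrr add0r opprD !opprK addrACA.
by rewrite [- A + C]addrC [- B + D]addrC opprB addrA.
Qed.

Lemma coord_coherent x : coherent p (fun n => coord n x %% q n)%Z.
Proof.
apply/asboolP => n; have [m [y Ky]] := coordinate n.+1 x.
rewrite (coord_eqmod Ky) modz_modz ?dvdz_exp2l //.
by apply/esym/(@coord_eqmod _ _ _ (y *~ p)); rewrite -mulrzA -exprS.
Qed.

Definition coord_fun x : padic_int p := PadicInt (coord_coherent x).

Lemma coord_fun_additive : zmod_morphism coord_fun.
Proof.
move=> x y; apply: padic_eq => n; rewrite residueB /=.
have [m [u Ku]] := coordinate n x; have [m' [v Kv]] := coordinate n y.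
rewrite (coord_eqmod Ku) (coord_eqmod Kv) -modzDmr modzNm modzDmr modzDml.
apply: (@coord_eqmod _ _ _ (u - v)).
have := KB Ku Kv; rewrite mulrzBr mulrzBl.
suff -> a b c a' b' c' : a - b - c - (a' - b' - c')
    = a - a' - (b - b') - (c - c') :> G by [].
by rewrite !opprD [LHS]addrACA [a - b + _]addrACA.
Qed.

Lemma coord_fun_base : coord_fun g = 1.
Proof.
apply: padic_eq => n /=; apply: (@coord_eqmod _ _ _ 0).
by rewrite mulr1z mul0rz subrr subr0.
Qed.
End Coordinate.

Lemma exists_unit_functional : exists f : dual p G, hom_fun f g = 1.
Proof.
have [K [indK K0 maxK]] := maximal_independent.
pose f := coord_fun indK K0 maxK.
pose fA := GRing.isZmodMorphism.Build _ _ f (coord_fun_additive indK K0 maxK).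
pose F : {additive G -> padic_int p} := HB.pack f fA.
by exists F; apply: coord_fun_base.
Qed.
End Separation.

(** * Norming functionals, and approximation in the double dual *)

Section Duality.
Variables (p : nat) (p_prime : prime p) (G : zmodType).
Local Notation q n := (p%:Z ^+ n).

Let p_gt0 : (0 < p)%N. Proof. exact: prime_gt0. Qed.

Lemma exact_power_decomp (g : G) : ~ (forall k, exists x, g = x *+ (p ^ k)%N) ->
  exists a x, g = x *+ (p ^ a)%N /\ ~ exists y, x = y *+ p.
Proof.
move=> /existsNP[k]; elim: k g => [|k IH] g gk.
  by case: gk; exists g; rewrite expn0.
have [[x gx]|ng] := pselect (exists x, g = x *+ p); last first.
  by exists 0%N, g; rewrite expn0.
have [|a [y [xy ny]]] := IH x.
  by move=> [y xy]; apply: gk; exists y; rewrite gx xy -mulrnA expnSr.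
by exists a.+1, y; rewrite gx xy -mulrnA expnSr.
Qed.

Lemma hom_fun_mulz (V : zmodType) (f : Defs.hom V (padic_int p)) (m : int) g :
  hom_fun f (g *~ m) = hom_fun f g *~ m.
Proof. exact: (raddfMz (f : {additive V -> padic_int p})). Qed.

Lemma hom_funB (V : zmodType) (f : Defs.hom V (padic_int p)) g h :
  hom_fun f (g - h) = hom_fun f g - hom_fun f h.
Proof. exact: (raddfB (f : {additive V -> padic_int p})). Qed.

Lemma hom_funD (V : zmodType) (f : Defs.hom V (padic_int p)) g h :
  hom_fun f (g + h) = hom_fun f g + hom_fun f h.
Proof. exact: (raddfD (f : {additive V -> padic_int p})). Qed.

(** If [g = x *+ p ^ a] with [x] not divisible by [p], a functional with value 1 at [x] takes the
    value [p ^ a] at [g]. For infinitely divisible [g], zero works. *)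
Lemma norming_functional (g : G) : torsion_free G -> exists f : dual p G,
  forall k, residue (hom_fun f g) k = 0 -> exists x, g = x *+ (p ^ k)%N.
Proof.
move=> G_tf; have [gd|/exact_power_decomp[a [x [-> nx]]]] :=
  pselect (forall k, exists x, g = x *+ (p ^ k)%N); first by exists 0.
have [f fx] := exists_unit_functional p_prime G_tf nx; exists f => k.
rewrite pmulrn hom_fun_mulz fx residue_mulz.
rewrite [residue 1 k]/= /reduce modzMmr mulr1 -PoszX => /dvdz_mod0P.
rewrite dvdz_Pexp2l; last by rewrite ger0_norm // ltz_nat prime_gt1.
by move=> ka; exists (x *+ (p ^ (a - k))%N); rewrite PoszX -pmulrn -mulrnA -expnD subnK.
Qed.

Lemma hom_fun_mulrn (f : dual p G) (n : nat) g : hom_fun (f *+ n) g = hom_fun f g *+ n.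
Proof. by rewrite -[LHS]/(Defs.eval g (f *+ n)) raddfMn. Qed.

(** The pointwise quotients by [p] are additive because [padic_int p] has no [p]-torsion. *)
Lemma dual_divisible_p (f : dual p G) :
  (forall g, residue (hom_fun f g) 1 = 0) -> exists f', f = f' *+ p.
Proof.
move=> f0; have /choice[h hE] : forall g, exists y, hom_fun f g = y *+ p.
  by move=> g; have /(padic_dvdP _ _ p_gt0)[y ->] := f0 g; exists y; rewrite expn1.
have h_additive : zmod_morphism h.
  move=> x y; apply/eqP; rewrite -subr_eq0; apply/eqP/padic_mulpI => //.
  rewrite !mulrnBl -!hE.
  by rewrite hom_funB subrr.
pose hA := GRing.isZmodMorphism.Build _ _ h h_additive.
pose F : {additive G -> padic_int p} := HB.pack h hA.
by exists F; apply: hom_eq => g; rewrite hom_fun_mulrn -hE.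
Qed.

Lemma residue_eq0_mulp (x : padic_int p) k : residue x k = 0 -> residue (x *+ p) k.+1 = 0.
Proof.
move=> /(padic_dvdP _ _ p_gt0)[y ->]; apply/padic_dvdP => //; exists y.
by rewrite -mulrnA expnSr.
Qed.

Lemma residue_eq0D (x y : padic_int p) k : residue x k = 0 -> residue y k = 0 -> residue (x + y) k = 0.
Proof. by move=> x0 y0; rewrite residueD x0 y0 mod0z. Qed.

Lemma residue_eq0M (x : padic_int p) (m : int) k : residue x k = 0 -> residue (x *~ m) k = 0.
Proof. by move=> x0; rewrite residue_mulz x0 mulr0 mod0z. Qed.

Lemma bidual_approx (psi : dual p (dual p G)) (s : seq (dual p G)) k :
  exists g, forall f, f \in s -> residue (hom_fun psi f - hom_fun f g) k = 0.
Proof.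
have [n] := ubnP (size s); elim: n s k => // n IHn s k.
elim: k s => [|k IHk] s sn.
  by exists 0 => f _; rewrite -residue_mod expr0 modz1.
have [s_div|] := pselect (forall f, f \in s -> forall g, residue (hom_fun f g) 1 = 0).
  have /choice[h hE] : forall f, exists f', f \in s -> f = f' *+ p.
    move=> f; have [/s_div/dual_divisible_p[f' ->]|] := boolP (f \in s).
      by exists f'.
    by exists 0.
  have [|g gE] := IHk (map h s); first by rewrite size_map.
  exists g => f fs; rewrite (hE f fs) hom_fun_mulrn.
  rewrite pmulrn hom_fun_mulz -pmulrn -mulrnBl.
  by apply/residue_eq0_mulp/gE/map_f.
move=> /existsNP[f0 /not_implyP[f0s /existsNP[g0 u0]]].
have /choice[c cE] : forall f : dual p G, exists c : int,
    residue (hom_fun f g0 - hom_fun f0 g0 *~ c) k.+1 = 0.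
  by move=> f; apply: residue_solve.
(* The list is one shorter, so the outer induction applies at full precision [k.+1]; each new
   functional vanishes at [g0] to that precision. *)
have [|g1 g1E] := IHn [seq f - f0 *~ c f | f <- rem f0 s] k.+1.
  rewrite size_map size_rem //; move: sn; rewrite ltnS; case: (s) f0s => // *.
(* Adding [g0 *~ m] corrects the value of [f0] and leaves those of the modified functionals
   unchanged modulo [p ^ k.+1]. *)
have [m mE] := residue_solve (hom_fun psi f0 - hom_fun f0 g1) k.+1 p_prime u0.
have f0E : residue (hom_fun psi f0 - hom_fun f0 (g1 + g0 *~ m)) k.+1 = 0.
  by rewrite hom_funD hom_fun_mulz opprD addrA.
exists (g1 + g0 *~ m) => f; rewrite (perm_mem (perm_to_rem f0s)) inE.
case/predU1P => [-> //|/(map_f (fun f => f - f0 *~ c f))/g1E].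
have -> : hom_fun (f - f0 *~ c f) g1 = hom_fun f g1 - hom_fun f0 g1 *~ c f.
  by rewrite -[LHS]/(Defs.eval g1 _) raddfB raddfMz.
rewrite hom_funB hom_fun_mulz => fE.
(* The error of [f] is that of [f - f0 *~ c f] at [g1], plus [c f] times the error of [f0], minus
   [m] times the defect in [cE]. *)
have := residue_eq0D (residue_eq0D fE (residue_eq0M (c f) f0E)) (residue_eq0M (- m) (cE f)).
rewrite !(hom_funD, hom_fun_mulz) mulrNz !mulrzBl mulrzDl -!mulrzA [c f * m]mulrC.
move: (hom_fun psi f) (_ *~ c f) (hom_fun f g1) (_ *~ c f) => A D F P.
move: (_ *~ _) (_ *~ _) => E H.
suff -> : A - P - (F - D) + (P - (D + H)) - (E - H) = A - (F + E) by [].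
rewrite (opprB F) [D - F]addrC [A - P + _]addrACA [- P + D]addrC -(opprB P D).
rewrite (opprD D) [P + _]addrA; move: (P - D) => U.
by rewrite (opprB E) opprD !addrA addrNK addrNK.
Qed.
End Duality.

(** * Isometry: comparing the metrics *)

(** Both sides are [padic_size] of a set of exponents, so equality of the sets suffices and no
    maximum is computed. *)
Lemma eq_pdist_abs (p : nat) (V : zmodType) (g h : V) (x : padic_int p) : prime p ->
  (forall k, residue x k = 0 <-> exists y, g - h = y *+ (p ^ k)%N) ->
  pdist p g h = padic_abs x.
Proof.
move=> pp gx; rewrite /pdist /padic_abs; congr (padic_size _ _).
apply/predeqP => k /=; rewrite -gx -padic_dvdP ?prime_gt0 //.
by split=> -[y ->]; exists y; rewrite -natrX mulr_natl.
Qed.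

Section Isometry.
Variables (p : nat) (p_prime : prime p) (G : zmodType).

Lemma Phi_divisible (g h : G) k :
  (exists x, g - h = x *+ (p ^ k)%N) ->
  exists psi, Phi p g - Phi p h = psi *+ (p ^ k)%N.
Proof.
move=> [x ghx]; exists (Phi p x); apply: hom_eq => f.
rewrite hom_fun_mulrn -[LHS]/(hom_fun f g - hom_fun f h) -hom_funB ghx.
by rewrite pmulrn hom_fun_mulz.
Qed.

Lemma Phi_divisible_residue (g h : G) k (f : dual p G) :
  (exists psi, Phi p g - Phi p h = psi *+ (p ^ k)%N) ->
  residue (hom_fun f (g - h)) k = 0.
Proof.
move=> [psi gh]; apply/(padic_dvdP _ _ (prime_gt0 p_prime)).
exists (hom_fun psi f); rewrite -hom_fun_mulrn -gh hom_funB.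
by [].
Qed.

(** Divisibility by [p ^ k] passes from [g - h] to its image under [Phi], then to its value at [f],
    and back to [g - h] because [f] is norming. *)
Lemma norming_pdist (g h : G) : torsion_free G -> exists f : dual p G,
  [/\ forall k, residue (hom_fun f (g - h)) k = 0 -> exists x, g - h = x *+ (p ^ k)%N,
      pdist p g h = padic_abs (hom_fun f (g - h)) &
      pdist p (Phi p g) (Phi p h) = padic_abs (hom_fun f (g - h))].
Proof.
move=> G_tf; have [f fE] := norming_functional p_prime (g - h) G_tf.
exists f; split=> //; apply: eq_pdist_abs => // k; split=> [/fE //|].
- by move/Phi_divisible/(Phi_divisible_residue f).
- exact: Phi_divisible.
- exact: Phi_divisible_residue.
Qed.

(** * Density for pointwise convergence *)

Lemma padic_abs_le_expn (x : padic_int p) k :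
  residue x k = 0 -> padic_abs x <= p%:R ^- k.
Proof.
move=> /(padic_dvdP _ _ (prime_gt0 p_prime)) [y xy].
have xk : exists z : padic_int p, x = p%:R ^+ k * z.
  by exists y; rewrite xy -natrX mulr_natl.
rewrite /padic_abs /padic_size; case: asboolP => [_|/padic_val_ex[_ /(_ k xk)]].
  by rewrite invr_ge0 exprn_ge0 // ler0n.
move=> kj; have p_gt0 : 0 < p%:R :> rat by rewrite ltr0n prime_gt0.
by rewrite lef_pV2 ?posrE ?exprn_gt0 // ler_weXn2l // ler1n prime_gt0.
Qed.

Lemma expn_lt_eps (e : rat) : 0 < e -> exists k, p%:R ^- k < e.
Proof.
move=> e0; have [k kE] : exists k : nat, e^-1 < k%:R.
  by exists (Num.Def.archi_bound e^-1); apply: archi_boundP; rewrite invr_ge0 ltW.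
exists k; rewrite -[e]invrK ltf_pV2 ?posrE ?invr_gt0 // ?exprn_gt0 ?ltr0n ?prime_gt0 //.
by apply: lt_trans kE _; rewrite -natrX ltr_nat ltn_expl // prime_gt1.
Qed.

(** The pointwise topology is the supremum of those induced by evaluations; constant functions show
    that evaluations are onto, as [cvg_image] requires. *)
Lemma ptws_cvg (U : Type) (V : topologicalType) (F : set_system (U -> V)) (f : U -> V) :
  Filter F -> (forall t, (fun h => h t) @ F --> f t) -> {ptws, F --> f}.
Proof.
move=> FF Ff; apply/cvg_sup => t; apply/cvg_image.
  by rewrite eqEsubset; split=> v // _; exists (fun=> v).
move=> W /Ff FW; exists ((fun h => h t) @^-1` W) => //.
by rewrite eqEsubset; split=> [v [? ? <-]|v Wv] //; exists (fun=> v).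
Qed.

Lemma Phi_dense : dense (range (Phi p) : set (dual2_relative p G)).
Proof.
move=> O [psi Opsi] [U oU UO].
pose B (i : seq (dual p G) * nat) :=
  [set g : G | forall f, f \in i.1 -> residue (hom_fun psi f - hom_fun f g) i.2 = 0].
(* The sets of approximants of [psi] generate a filter on [G] along which [Phi] tends to [psi]
   pointwise; [bidual_approx] makes each of them nonempty. *)
pose F := filter_from [set: seq (dual p G) * nat] B.
have FF : Filter F.
  apply: filter_from_filter; first by exists ([::], 0%N).
  move=> [s k] [t l] _ _; exists (s ++ t, maxn k l) => // g Bg; split=> f fi.
    rewrite (@residue_le _ _ _ (maxn k l)) ?leq_maxl // Bg ?mod0z //.
    by rewrite mem_cat fi.
  rewrite (@residue_le _ _ _ (maxn k l)) ?leq_maxr // Bg ?mod0z //.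
  by rewrite mem_cat fi orbT.
have cvgF : {ptws, (fun g => dual2_fun (Phi p g)) @ F --> dual2_fun psi}.
  apply: ptws_cvg => f; apply/cvg_ballP => e e0.
  have [k ke] := expn_lt_eps e0.
  exists ([:: f], k) => //= g Bg.
  apply: le_lt_trans ke; apply: padic_abs_le_expn; apply: Bg; exact: mem_head.
have : nbhs (dual2_fun psi : {ptws dual p G -> padic_int p}) U.
  by apply: open_nbhs_nbhs; split=> //; rewrite -UO in Opsi.
move=> /cvgF [[s k] _ BU].
have [g gB] := bidual_approx p_prime psi s k.
exists (Phi p g); split; last by exists g.
by rewrite -UO; apply: BU.
Qed.
End Isometry.

Theorem theorem3p31 (p : nat) (p_prime : prime p)
    (G : zmodType) (G_tf : torsion_free G) :
  [/\ forall g h : G, pdist p (Phi p g) (Phi p h) = pdist p g h,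
      forall g : G,
        pdist p g 0 = pdist p (Phi p g) 0 /\
        is_max [set padic_abs (hom_fun (Phi p g) f) | f in [set: dual p G]]
               (pdist p (Phi p g) 0)
    & dense (range (Phi p) : set (dual2_relative p G))].
Proof.
split=> [g h|g|]; last exact: Phi_dense.
  by have [f [_ -> ->]] := norming_pdist p_prime g h G_tf.
have Phi0 : Phi p (0 : G) = 0.
  by apply: hom_eq => f; exact: (raddf0 (f : {additive G -> padic_int p})).
have [f [fE gE]] := norming_pdist p_prime g 0 G_tf.
rewrite Phi0 subr0 in fE gE * => PhigE; rewrite gE PhigE; split=> //.
split=> [|_ [f' _ <-]]; first by exists f.
apply: le_padic_abs => k [y].
rewrite -natrX mulr_natl => fy.
(* The norming [f] attains the maximum: if [p ^ k] divides its value at [g], it divides [g] and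
   hence every [f'] value at [g]. *)
have /fE[x ->] : residue (hom_fun f g) k = 0.
  by apply/(padic_dvdP _ _ (prime_gt0 p_prime)); exists y.
exists (hom_fun f' x); rewrite mulr_natl pmulrn.
exact: hom_fun_mulz.
Qed.
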